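(* Let $H$ be a finitely generated residually finite group and let $(Y,H)$ be a free $H$-odometer. Suppose a free dynamical system $(X,G)$, with $X$ a Cantor set and $G$ a countable group, is continuously orbit equivalent to $(Y,H)$. Then $(X,G)$ is topologically conjugate to a free $G$-odometer which is structurally conjugate to $(Y,H)$. In particular $G$ and $H$ have isomorphic subgroups of the same finite index.
   Context: Free: $g\cdot x=x$ implies $g=e$. $G$-odometer: for a decreasing sequence $G_0\supseteq G_1\supseteq\cdots$ of finite-index subgroups of $G$ (not necessarily normal), the inverse limit $\varprojlim(G/G_n,\pi_n)$ of left coset spaces under the natural maps $\pi_n:G/G_n\to G/G_{n-1}$, with $G$ acting by left multiplication coordinatewise; we say $\{G_n\}$ determines a system if the system is conjugate to this odometer. Continuous orbit equivalence of $(X,G)$ and $(Y,H)$: a homeomorphism $\psi:X\to Y$ with $\psi(G\cdot x)=H\cdot\psi(x)$ for all $x$, such that for every $x\in X$, $g\in G$ there are $h\in H$ and a clopen neighborhood $U$ of $x$ with $\psi(g\cdot z)=h\cdot\psi(z)$ for $z\in U$, and symmetrically for $\psi^{-1}$. Structural conjugacy of odometers $(X,G)$ and $(Y,H)$: there exist decreasing sequences of finite-index subgroups $\{G_n\}_{n\ge0}$ of $G$ and $\{H_n\}_{n\ge0}$ of $H$ determining $(X,G)$ and $(Y,H)$ respectively, and a group isomorphism $\theta:H_0\to G_0$ with $\theta(H_n)=G_n$ for all $n\ge0$ and $[G:G_0]=[H:H_0]<\infty$. *)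

(* Defs.v *)
From Stdlib Require Import Reals List Arith Lia.
Set Implicit Arguments.

Record Group := {
  gcar :> Type;
  gmul : gcar -> gcar -> gcar;
  gone : gcar;
  ginv : gcar -> gcar;
  gmul_assoc : forall a b c, gmul a (gmul b c) = gmul (gmul a b) c;
  gmul_1l : forall a, gmul gone a = a;
  gmul_1r : forall a, gmul a gone = a;
  gmul_Vl : forall a, gmul (ginv a) a = gone;
  gmul_Vr : forall a, gmul a (ginv a) = gone }.

Definition is_subgroup {G : Group} (K : G -> Prop) : Prop :=
  K (gone G) /\ (forall a b, K a -> K b -> K (gmul G a b)) /\
  (forall a, K a -> K (ginv G a)).

Definition is_normal {G : Group} (K : G -> Prop) : Prop :=
  is_subgroup K /\ forall g k, K k -> K (gmul G (gmul G g k) (ginv G g)).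

Definition has_index {G : Group} (K : G -> Prop) (n : nat) : Prop :=
  exists reps : list G, length reps = n /\
    (forall i j, i < n -> j < n -> i <> j ->
        ~ K (gmul G (ginv G (nth i reps (gone G))) (nth j reps (gone G)))) /\
    (forall g, exists r, In r reps /\ K (gmul G (ginv G r) g)).

Definition finite_index {G : Group} (K : G -> Prop) : Prop :=
  is_subgroup K /\ exists n, has_index K n.

Definition countable_group (G : Group) : Prop :=
  exists f : nat -> G, forall g, exists n, f n = g.

Definition generated_by {G : Group} (S : list G) (g : G) : Prop :=
  forall K : G -> Prop, is_subgroup K -> (forall s, In s S -> K s) -> K g.

Definition finitely_generated (G : Group) : Prop :=
  exists S : list G, forall g, generated_by S g.

Definition residually_finite (G : Group) : Prop :=
  forall g : G, g <> gone G ->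
    exists N : G -> Prop, is_normal N /\ finite_index N /\ ~ N g.

Definition is_topology {X : Type} (op : (X -> Prop) -> Prop) : Prop :=
  op (fun _ => True) /\ op (fun _ => False) /\
  (forall U V, op U -> op V -> op (fun x => U x /\ V x)) /\
  (forall F : (X -> Prop) -> Prop, (forall U, F U -> op U) ->
     op (fun x => exists U, F U /\ U x)).

Definition clopen {X : Type} (op : (X -> Prop) -> Prop) (U : X -> Prop) : Prop :=
  op U /\ op (fun x => ~ U x).

Definition continuous {X Y : Type} (opX : (X -> Prop) -> Prop)
  (opY : (Y -> Prop) -> Prop) (f : X -> Y) : Prop :=
  forall V, opY V -> opX (fun x => V (f x)).

Definition homeomorphism {X Y : Type} (opX : (X -> Prop) -> Prop)
  (opY : (Y -> Prop) -> Prop) (f : X -> Y) : Prop :=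
  exists f' : Y -> X, (forall x, f' (f x) = x) /\ (forall y, f (f' y) = y) /\
    continuous opX opY f /\ continuous opY opX f'.

Definition compact {X : Type} (op : (X -> Prop) -> Prop) : Prop :=
  forall F : (X -> Prop) -> Prop, (forall U, F U -> op U) ->
    (forall x, exists U, F U /\ U x) ->
    exists l : list (X -> Prop), (forall U, In U l -> F U) /\
       (forall x, exists U, In U l /\ U x).

Definition metrizable {X : Type} (op : (X -> Prop) -> Prop) : Prop :=
  exists d : X -> X -> R,
    (forall x y, (0 <= d x y)%R) /\ (forall x y, d x y = 0%R <-> x = y) /\
    (forall x y, d x y = d y x) /\ (forall x y z, (d x z <= d x y + d y z)%R) /\
    (forall U, op U <-> forall x, U x -> exists eps, (0 < eps)%R /\
        forall y, (d x y < eps)%R -> U y).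

Definition connected_subset {X : Type} (op : (X -> Prop) -> Prop) (A : X -> Prop) : Prop :=
  ~ exists U V, op U /\ op V /\ (forall x, A x -> U x \/ V x) /\
      (forall x, A x -> U x -> V x -> False) /\
      (exists x, A x /\ U x) /\ (exists x, A x /\ V x).

Definition totally_disconnected {X : Type} (op : (X -> Prop) -> Prop) : Prop :=
  forall A, connected_subset op A -> forall x y, A x -> A y -> x = y.

Definition cantor_space {X : Type} (op : (X -> Prop) -> Prop) : Prop :=
  is_topology op /\ (exists x : X, True) /\ compact op /\ metrizable op /\
  totally_disconnected op /\ (forall x : X, ~ op (fun y => y = x)).

Definition continuous_action {G : Group} {X : Type} (op : (X -> Prop) -> Prop)
  (act : G -> X -> X) : Prop :=
  (forall x, act (gone G) x = x) /\
  (forall g h x, act (gmul G g h) x = act g (act h x)) /\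
  (forall g, continuous op op (act g)).

Definition free_action {G : Group} {X : Type} (act : G -> X -> X) : Prop :=
  forall g x, act g x = x -> g = gone G.

Definition is_left_coset {G : Group} (K : G -> Prop) (C : G -> Prop) : Prop :=
  exists g : G, forall x, C x <-> K (gmul G (ginv G g) x).

(* points of the inverse limit of G/G_n: compatible sequences of left cosets *)
Definition odo_point {G : Group} (Gs : nat -> G -> Prop) (c : nat -> G -> Prop) : Prop :=
  (forall n, is_left_coset (Gs n) (c n)) /\ (forall n x, c (S n) x -> c n x).

Definition Odo {G : Group} (Gs : nat -> G -> Prop) : Type :=
  { c : nat -> G -> Prop | odo_point Gs c }.

(* inverse limit (product of discrete) topology *)
Definition odo_open {G : Group} (Gs : nat -> G -> Prop) (U : Odo Gs -> Prop) : Prop :=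
  forall c, U c -> exists n, forall d : Odo Gs,
    (forall k, k <= n -> proj1_sig d k = proj1_sig c k) -> U d.

Definition odo_act_rel {G : Group} (Gs : nat -> G -> Prop) (g : G) (c d : Odo Gs) : Prop :=
  forall n y, proj1_sig d n y <-> proj1_sig c n (gmul G (ginv G g) y).

Definition odo_free {G : Group} (Gs : nat -> G -> Prop) : Prop :=
  forall (g : G) (c : Odo Gs), odo_act_rel g c c -> g = gone G.

Definition decreasing_fi_seq {G : Group} (Gs : nat -> G -> Prop) : Prop :=
  (forall n, finite_index (Gs n)) /\ (forall n x, Gs (S n) x -> Gs n x).

Definition determines {G : Group} (Gs : nat -> G -> Prop) {X : Type}
  (op : (X -> Prop) -> Prop) (act : G -> X -> X) : Prop :=
  decreasing_fi_seq Gs /\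
  exists phi : X -> Odo Gs, homeomorphism op (@odo_open G Gs) phi /\
    forall g x, odo_act_rel g (phi x) (phi (act g x)).

Definition is_odometer {G : Group} {X : Type} (op : (X -> Prop) -> Prop)
  (act : G -> X -> X) : Prop :=
  exists Gs, determines Gs op act.

Definition structurally_conjugate {G : Group} {X : Type} (opX : (X -> Prop) -> Prop)
  (actX : G -> X -> X) {H : Group} {Y : Type} (opY : (Y -> Prop) -> Prop)
  (actY : H -> Y -> Y) : Prop :=
  exists (Gs : nat -> G -> Prop) (Hs : nat -> H -> Prop) (theta : H -> G),
    determines Gs opX actX /\ determines Hs opY actY /\
    (forall a b, Hs 0 a -> Hs 0 b -> theta (gmul H a b) = gmul G (theta a) (theta b)) /\
    (forall a b, Hs 0 a -> Hs 0 b -> theta a = theta b -> a = b) /\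
    (* theta(H_n) = G_n for all n (n = 0 gives surjectivity onto G_0) *)
    (forall n g, Gs n g <-> exists h, Hs n h /\ theta h = g) /\
    (exists k, has_index (Gs 0) k /\ has_index (Hs 0) k).

Definition continuously_orbit_equivalent {G : Group} {X : Type}
  (opX : (X -> Prop) -> Prop) (actX : G -> X -> X) {H : Group} {Y : Type}
  (opY : (Y -> Prop) -> Prop) (actY : H -> Y -> Y) : Prop :=
  exists (psi : X -> Y) (psi' : Y -> X),
    (forall x, psi' (psi x) = x) /\ (forall y, psi (psi' y) = y) /\
    continuous opX opY psi /\ continuous opY opX psi' /\
    (forall x y, (exists g, y = actX g x) <-> (exists h, psi y = actY h (psi x))) /\
    (forall x g, exists h U, clopen opX U /\ U x /\
        forall z, U z -> psi (actX g z) = actY h (psi z)) /\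
    (forall y h, exists g V, clopen opY V /\ V y /\
        forall z, V z -> psi' (actY h z) = actX g (psi' z)).

(* Main.v *)
(** Fix an odometer sequence [(H_n)] for [Y].  Continuous orbit equivalence and
    freeness give a cocycle [c : H -> Y -> G] with
    [psi' (h y) = c h y (psi' y)], locally constant in [y].  By compactness and
    finite generation there is a single level [N] such that every [c h]
    factors through [H/H_N]; discard the levels below [N].  For the point [y0]
    coding the trivial cosets, [theta h := c h y0] is a bijection from [H] to
    [G] which is multiplicative on [H_N], and [G_n := theta (H_n)] satisfies
    [theta(a)^-1 theta(b) \in G_n <-> a^-1 b \in H_n] for all [a, b] in [H].
    Hence [theta] carries the coset coding of [Y] to a coset coding of [X] and
    preserves indices. *)

Require Import Defs.
From Stdlib Require Import Reals List Arith Lia.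
From Stdlib Require Import ClassicalEpsilon FunctionalExtensionality
  PropExtensionality ProofIrrelevance.

(** * Choice, extensionality and transfer of open sets *)

Lemma choose {A B : Type} (R : A -> B -> Prop) :
  (forall a, exists b, R a b) -> exists f : A -> B, forall a, R a (f a).
Proof.
  intros h.
  exists (fun a => proj1_sig (constructive_indefinite_description _ (h a))).
  intros a; exact (proj2_sig (constructive_indefinite_description _ (h a))).
Qed.

Lemma set_ext {A : Type} (U V : A -> Prop) : (forall a, U a <-> V a) -> U = V.
Proof.
  intros h; apply functional_extensionality; intros a.
  apply propositional_extensionality, h.
Qed.

Lemma homeomorphism_open {X Y : Type} (opX : (X -> Prop) -> Prop)
  (opY : (Y -> Prop) -> Prop) (f : X -> Y) (f' : Y -> X) (U : X -> Prop) :
  (forall x, f' (f x) = x) -> continuous opX opY f -> continuous opY opX f' ->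
  opX U <-> opY (fun y => U (f' y)).
Proof.
  intros f'f cf cf'; split; intros hU.
  - exact (cf' U hU).
  - replace U with (fun x => U (f' (f x))).
    + exact (cf _ hU).
    + apply set_ext; intros x; rewrite f'f; reflexivity.
Qed.

(** * Groups *)

Section GroupFacts.
Variable G : Group.
Implicit Types a b : G.

Lemma gmul_cancel_l a b1 b2 : gmul G a b1 = gmul G a b2 -> b1 = b2.
Proof.
  intros e.
  rewrite <- (gmul_1l G b1), <- (gmul_1l G b2), <- (gmul_Vl G a), <- !gmul_assoc, e.
  reflexivity.
Qed.

Lemma gmul_KV a b : gmul G a (gmul G (ginv G a) b) = b.
Proof. rewrite gmul_assoc, gmul_Vr, gmul_1l; reflexivity. Qed.

Lemma gmul_VK a b : gmul G (ginv G a) (gmul G a b) = b.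
Proof. rewrite gmul_assoc, gmul_Vl, gmul_1l; reflexivity. Qed.

Lemma ginv_1 : ginv G (gone G) = gone G.
Proof. rewrite <- (gmul_1l G (ginv G (gone G))); apply gmul_Vr. Qed.

Lemma ginv_V a : ginv G (ginv G a) = a.
Proof. apply (gmul_cancel_l (ginv G a)); rewrite gmul_Vl, gmul_Vr; reflexivity. Qed.

Lemma ginv_M a b : ginv G (gmul G a b) = gmul G (ginv G b) (ginv G a).
Proof.
  apply (gmul_cancel_l (gmul G a b)).
  rewrite gmul_Vr, <- gmul_assoc, gmul_KV, gmul_Vr; reflexivity.
Qed.

Lemma gmul_assoc_r a b c : gmul G (gmul G a b) c = gmul G a (gmul G b c).
Proof. symmetry; apply gmul_assoc. Qed.

End GroupFacts.

#[local] Hint Rewrite gmul_assoc_r gmul_1l gmul_1r gmul_Vl gmul_Vr gmul_KV gmul_VK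
  ginv_1 ginv_V ginv_M : gnorm.
Ltac gnorm := autorewrite with gnorm.
Tactic Notation "gnorm" "in" hyp(h) := autorewrite with gnorm in h.

Section SubgroupCosets.
Variables (G : Group) (K : G -> Prop).
Hypothesis hK : is_subgroup K.
Implicit Types a b c : G.

Lemma coset_refl a : K (gmul G (ginv G a) a).
Proof. gnorm; apply hK. Qed.

Lemma coset_sym a b : K (gmul G (ginv G a) b) -> K (gmul G (ginv G b) a).
Proof. intros h; apply hK in h; gnorm in h; exact h. Qed.

Lemma coset_trans a b c :
  K (gmul G (ginv G a) b) -> K (gmul G (ginv G b) c) -> K (gmul G (ginv G a) c).
Proof.
  intros h1 h2; pose proof (proj1 (proj2 hK) _ _ h1 h2) as h; gnorm in h; exact h.
Qed.

End SubgroupCosets.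

Section FreeAction.
Variables (G : Group) (X : Type) (op : (X -> Prop) -> Prop) (act : G -> X -> X).
Hypothesis hact : continuous_action op act.

Lemma act_VK g x : act (ginv G g) (act g x) = x.
Proof.
  destruct hact as (h1 & hM & _); rewrite <- hM, gmul_Vl; apply h1.
Qed.

Lemma act_KV g x : act g (act (ginv G g) x) = x.
Proof.
  destruct hact as (h1 & hM & _); rewrite <- hM, gmul_Vr; apply h1.
Qed.

Lemma free_act_inj : free_action act -> forall g g' x, act g x = act g' x -> g = g'.
Proof.
  intros hfree g g' x e; apply (gmul_cancel_l G (ginv G g')).
  rewrite gmul_Vl; apply (hfree _ x).
  destruct hact as (_ & hM & _); rewrite hM, e; apply act_VK.
Qed.

End FreeAction.

(** * Odometers as coset codings *)

(* [P n g x] reads: the [n]-th coordinate of [x] is the coset [g G_n]. *)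
Record coset_coding {G : Group} (Gs : nat -> G -> Prop) {X : Type}
  (op : (X -> Prop) -> Prop) (act : G -> X -> X) (P : nat -> G -> X -> Prop) : Prop := {
  cc_seq : decreasing_fi_seq Gs;
  cc_coset : forall n g x, P n g x -> forall g', P n g' x <-> Gs n (gmul G (ginv G g) g');
  cc_total : forall n x, exists g, P n g x;
  cc_dec : forall n g x, P (S n) g x -> P n g x;
  cc_act : forall n g k x, P n g (act k x) <-> P n (gmul G (ginv G k) g) x;
  cc_open : forall U, op U <->
    forall x, U x -> exists n, forall g z, P n g x -> P n g z -> U z;
  cc_complete : forall a : nat -> G, (forall n, Gs n (gmul G (ginv G (a n)) (a (S n)))) ->
    exists x, forall n, P n (a n) x;
  cc_sep : forall x z, (forall n, exists g, P n g x /\ P n g z) -> x = z }.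

Arguments cc_seq {G Gs X op act P}.
Arguments cc_coset {G Gs X op act P}.
Arguments cc_total {G Gs X op act P}.
Arguments cc_dec {G Gs X op act P}.
Arguments cc_act {G Gs X op act P}.
Arguments cc_open {G Gs X op act P}.
Arguments cc_complete {G Gs X op act P}.
Arguments cc_sep {G Gs X op act P}.

Lemma odo_ext {G : Group} {Gs : nat -> G -> Prop} (c d : Odo Gs) :
  (forall n g, proj1_sig c n g <-> proj1_sig d n g) -> c = d.
Proof.
  destruct c as [c hc], d as [d hd]; simpl; intros h.
  assert (e : c = d).
  { apply functional_extensionality; intros n; apply set_ext, h. }
  subst d; f_equal; apply proof_irrelevance.
Qed.

Lemma left_coset_mem {G : Group} (K C : G -> Prop) :
  is_subgroup K -> is_left_coset K C ->
  forall g, C g -> forall g', C g' <-> K (gmul G (ginv G g) g').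
Proof.
  intros hK [a ha] g hg g'; apply ha in hg; rewrite ha; split; intros h.
  - exact (coset_trans G K hK _ _ _ (coset_sym G K hK _ _ hg) h).
  - exact (coset_trans G K hK _ _ _ hg h).
Qed.

Lemma left_coset_nonempty {G : Group} (K C : G -> Prop) :
  is_subgroup K -> is_left_coset K C -> exists g, C g.
Proof. intros hK [a ha]; exists a; apply ha, coset_refl, hK. Qed.

Lemma odo_point_antitone {G : Group} {Gs : nat -> G -> Prop} (c : nat -> G -> Prop) :
  odo_point Gs c -> forall n k g, k <= n -> c n g -> c k g.
Proof.
  intros [_ hc] n k g hkn h; induction hkn; auto.
Qed.

(** The elements of the [n]-th coordinate of [phi x] give the coding. A relation on the space itself
    is easier to transport than sequences of sets. *)
Lemma determines_coset_coding {G : Group} {Gs : nat -> G -> Prop} {X : Type}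
  {op : (X -> Prop) -> Prop} {act : G -> X -> X} :
  determines Gs op act -> exists P, coset_coding Gs op act P.
Proof.
  intros [hseq (phi & (phi' & phi'phi & phiphi' & cphi & cphi') & hphi)].
  exists (fun n g x => proj1_sig (phi x) n g).
  assert (hsub : forall n, is_subgroup (Gs n)) by (intros n; apply hseq).
  assert (hcos : forall n g x, proj1_sig (phi x) n g -> forall g',
    proj1_sig (phi x) n g' <-> Gs n (gmul G (ginv G g) g')).
  { intros n g x; apply left_coset_mem; [apply hsub | apply (proj2_sig (phi x))]. }
  split.
  - exact hseq.
  - exact hcos.
  - intros n x; apply (left_coset_nonempty (Gs n)); [apply hsub | apply (proj2_sig (phi x))].
  - intros n g x; apply (proj2_sig (phi x)).
  - intros n g k x; apply hphi.
  - intros U; rewrite (homeomorphism_open op (@odo_open G Gs) phi phi' U phi'phi cphi cphi').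
    split.
    + intros hU x hx; destruct (hU (phi x)) as [n hn].
      { rewrite phi'phi; exact hx. }
      exists n; intros g z hgx hgz; rewrite <- (phi'phi z); apply hn.
      (* A common representative at level [n] is also one at each level [k <= n], and it determines
         the cosets there. *)
      intros k hkn; apply set_ext; intros g'.
      pose proof (odo_point_antitone _ (proj2_sig (phi x)) n k g hkn hgx) as h1.
      pose proof (odo_point_antitone _ (proj2_sig (phi z)) n k g hkn hgz) as h2.
      rewrite (hcos k g x h1), (hcos k g z h2); reflexivity.
    + intros hU c hc; destruct (hU _ hc) as [n hn]; exists n; intros d hd.
      destruct (left_coset_nonempty (Gs n) (proj1_sig c n)) as [g hg];
        [apply hsub | apply (proj2_sig c) |].
      apply (hn g); rewrite phiphi'; [exact hg |].
      rewrite hd; [exact hg | apply le_n].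
  - intros a ha.
    assert (hc : odo_point Gs (fun n g => Gs n (gmul G (ginv G (a n)) g))).
    { split; [intros n; exists (a n); reflexivity |].
      intros n g hg; apply (coset_trans G (Gs n) (hsub n) _ (a (S n))); [apply ha |].
      apply hseq, hg. }
    exists (phi' (exist _ _ hc)); intros n; rewrite phiphi'; exact (coset_refl G _ (hsub n) (a n)).
  - intros x z h; rewrite <- (phi'phi x), <- (phi'phi z); f_equal.
    apply odo_ext; intros n g; destruct (h n) as (k & hx & hz).
    rewrite (hcos n k x hx), (hcos n k z hz); reflexivity.
Qed.

(** The way back: [x] goes to the sequence of its cosets. This map is onto by [cc_complete] and
    one-to-one by [cc_sep]. *)
Lemma coset_coding_determines {G : Group} {Gs : nat -> G -> Prop} {X : Type}
  {op : (X -> Prop) -> Prop} {act : G -> X -> X} {P : nat -> G -> X -> Prop} :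
  coset_coding Gs op act P -> determines Gs op act.
Proof.
  intros hP; pose proof (cc_seq hP) as hseq; split; [exact hseq |].
  assert (hsub : forall n, is_subgroup (Gs n)) by (intros n; apply hseq).
  assert (hpt : forall x, odo_point Gs (fun n g => P n g x)).
  { intros x; split; [| intros n g; apply (cc_dec hP)].
    intros n; destruct (cc_total hP n x) as [g hg]; exists g; exact (cc_coset hP n g x hg). }
  set (phi := fun x => exist _ _ (hpt x) : Odo Gs).
  assert (hsurj : forall c : Odo Gs, exists x, phi x = c).
  { intros [c hc].
    destruct (choose (fun n g => c n g)) as [a ha].
    { intros n; apply (left_coset_nonempty (Gs n)); [apply hsub | apply hc]. }
    assert (hmem : forall n g, c n g <-> Gs n (gmul G (ginv G (a n)) g)).
    { intros n; apply left_coset_mem; [apply hsub | apply hc | apply ha]. }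
    destruct (cc_complete hP a) as [x hx].
    { intros n; apply hmem, hc, ha. }
    exists x; apply odo_ext; simpl; intros n g.
    rewrite hmem; apply (cc_coset hP), hx. }
  destruct (choose _ hsurj) as [phi' phiphi'].
  assert (phi'phi : forall x, phi' (phi x) = x).
  { intros x; apply (cc_sep hP); intros n; destruct (cc_total hP n x) as [g hg].
    exists g; split; [| exact hg].
    change (proj1_sig (phi (phi' (phi x))) n g); rewrite phiphi'; exact hg. }
  exists phi; split.
  - exists phi'; repeat split; [exact phi'phi | exact phiphi' | |].
    + intros V hV; apply (cc_open hP); intros x hx; destruct (hV _ hx) as [n hn].
      exists n; intros g z hgx hgz; apply hn; intros k hkn; apply set_ext; intros g'; simpl.
      pose proof (odo_point_antitone _ (hpt x) n k g hkn hgx) as h1.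
      pose proof (odo_point_antitone _ (hpt z) n k g hkn hgz) as h2.
      rewrite (cc_coset hP k g x h1), (cc_coset hP k g z h2); reflexivity.
    + intros U hU c hc; destruct (proj1 (cc_open hP U) hU _ hc) as [n hn].
      exists n; intros d hd.
      destruct (cc_total hP n (phi' c)) as [g hg].
      apply (hn g); [exact hg |].
      change (proj1_sig (phi (phi' d)) n g); rewrite phiphi', hd by apply le_n.
      rewrite <- (phiphi' c); exact hg.
  - intros g x n y; apply (cc_act hP).
Qed.

Lemma determines_free {G : Group} {Gs : nat -> G -> Prop} {X : Type}
  {op : (X -> Prop) -> Prop} {act : G -> X -> X} :
  determines Gs op act -> free_action act -> odo_free Gs.
Proof.
  intros [_ (phi & (phi' & phi'phi & phiphi' & _ & _) & hphi)] hfree g c hc.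
  apply (hfree g (phi' c)).
  rewrite <- (phi'phi (act g (phi' c))); f_equal; apply odo_ext; intros n y.
  rewrite (hphi g (phi' c) n y), phiphi'; symmetry; apply hc.
Qed.

(** * Cells of a coding and passage to a tail *)

Section Coding.
Variables (G : Group) (Gs : nat -> G -> Prop) (X : Type) (op : (X -> Prop) -> Prop).
Variables (act : G -> X -> X) (P : nat -> G -> X -> Prop).
Hypothesis hP : coset_coding Gs op act P.

Lemma coding_antitone m n g x : m <= n -> P n g x -> P m g x.
Proof. intros hmn h; induction hmn; [exact h | apply IHhmn, (cc_dec hP), h]. Qed.

Lemma coding_cell_trans n g g' x z : P n g x -> P n g z -> P n g' x -> P n g' z.
Proof.
  intros hx hz hx'; apply (cc_coset hP n g z hz), (cc_coset hP n g x hx), hx'.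
Qed.

Lemma coding_act n g k x : P n g x -> P n (gmul G k g) (act k x).
Proof. intros h; apply (cc_act hP); gnorm; exact h. Qed.

(** A tail of the subgroup sequence has the same inverse limit. This is what lets level [N] be
    renamed level 0. *)
Lemma coding_shift N :
  coset_coding (fun n => Gs (N + n)) op act (fun n => P (N + n)).
Proof.
  split.
  - split; [intros n; apply (cc_seq hP) |].
    intros n x; rewrite <- plus_n_Sm; apply (cc_seq hP).
  - intros n; apply (cc_coset hP).
  - intros n; apply (cc_total hP).
  - intros n g x; rewrite <- plus_n_Sm; apply (cc_dec hP).
  - intros n; apply (cc_act hP).
  - intros U; rewrite (cc_open hP); split; intros h x hx; destruct (h x hx) as [n hn].
    + exists n; intros g z hgx hgz.
      apply (hn g); apply (coding_antitone n (N + n)); auto; lia.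
    + exists (N + n); exact hn.
  - intros a ha.
    (* Truncated subtraction extends the given sequence below level [N] by the constant [a 0], so
       compatibility is trivial there. *)
    destruct (cc_complete hP (fun m => a (m - N))) as [x hx].
    + intros m; destruct (le_lt_dec N m) as [h | h].
      * specialize (ha (m - N)).
        replace (N + (m - N)) with m in ha by lia.
        replace (S m - N) with (S (m - N)) by lia; exact ha.
      * replace (S m - N) with 0 by lia; replace (m - N) with 0 by lia.
        apply coset_refl, (cc_seq hP).
    + exists x; intros n; specialize (hx (N + n)).
      replace (N + n - N) with n in hx by lia; exact hx.
  - intros x z h; apply (cc_sep hP); intros n; destruct (h n) as (g & hx & hz).
    exists g; split; apply (coding_antitone n (N + n)); auto; lia.
Qed.

Lemma coding_cell_open n x : op (fun z => exists g, P n g x /\ P n g z).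
Proof.
  apply (cc_open hP); intros z (g & hx & hz); exists n; intros g' w hz' hw.
  exists g; split; [exact hx |].
  exact (coding_cell_trans n g' g z w hz' hw hz).
Qed.

End Coding.

(** * The orbit cocycle *)

Section OrbitEquivalence.
Variables (G H : Group) (X Y : Type).
Variables (opX : (X -> Prop) -> Prop) (actX : G -> X -> X).
Variables (opY : (Y -> Prop) -> Prop) (actY : H -> Y -> Y).
Hypothesis hXact : continuous_action opX actX.
Hypothesis hXfree : free_action actX.
Hypothesis hYact : continuous_action opY actY.
Hypothesis hYfree : free_action actY.

Variables (psi : X -> Y) (psi' : Y -> X).
Hypothesis psi'psi : forall x, psi' (psi x) = x.
Hypothesis psipsi' : forall y, psi (psi' y) = y.
Hypothesis cpsi : continuous opX opY psi.
Hypothesis cpsi' : continuous opY opX psi'.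
Hypothesis horbit : forall g x, exists h, psi (actX g x) = actY h (psi x).

Variable c : H -> Y -> G.
Hypothesis hc : forall h y, psi' (actY h y) = actX (c h y) (psi' y).

(** This is freeness of the [G]-action; it reduces each cocycle identity below to an equation
    between points of [X]. *)
Lemma cocycle_unique h y g : psi' (actY h y) = actX g (psi' y) -> c h y = g.
Proof.
  intros e; apply (free_act_inj G X opX actX hXact hXfree _ _ (psi' y)).
  rewrite <- hc; exact e.
Qed.

Lemma cocycle_mul a b y : c (gmul H a b) y = gmul G (c a (actY b y)) (c b y).
Proof.
  apply cocycle_unique.
  rewrite (proj1 (proj2 hXact)), (proj1 (proj2 hYact)), <- !hc; reflexivity.
Qed.

Lemma cocycle_one y : c (gone H) y = gone G.
Proof.
  apply cocycle_unique; rewrite (proj1 hXact), (proj1 hYact); reflexivity.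
Qed.

Lemma cocycle_inv a y : c (ginv H a) y = ginv G (c a (actY (ginv H a) y)).
Proof.
  apply cocycle_unique.
  rewrite <- (act_VK G X opX actX hXact (c a (actY (ginv H a) y))) at 1.
  rewrite <- hc, (act_KV H Y opY actY hYact); reflexivity.
Qed.

(** Equal values send [a y] and [b y] to the same point under the injective [psi']; freeness of the
    [H]-action then gives [a = b]. *)
Lemma cocycle_inj a b y : c a y = c b y -> a = b.
Proof.
  intros e; apply (free_act_inj H Y opY actY hYact hYfree _ _ y).
  rewrite <- (psipsi' (actY a y)), <- (psipsi' (actY b y)), !hc, e; reflexivity.
Qed.

(** * Uniform local constancy of the cocycle *)

Section Coded.
Variables (Hs : nat -> H -> Prop) (P : nat -> H -> Y -> Prop).
Hypothesis hP : coset_coding Hs opY actY P.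

(** The shared [k] places [y] and [z] in one level-[n] cell, so this says that [c h] factors through
    [H/H_n]. *)
Definition level_constant (n : nat) (h : H) : Prop :=
  forall y z k, P n k y -> P n k z -> c h y = c h z.

Lemma level_constant_mono m n h : m <= n -> level_constant m h -> level_constant n h.
Proof.
  intros hmn hm y z k hy hz.
  apply (hm y z k); eapply (coding_antitone _ _ _ _ _ _ hP); eauto.
Qed.

(** The cocycle identities give this, because the action sends level-[n] cells into level-[n] cells.
    It reduces uniformity over [H] to generators. *)
Lemma level_constant_subgroup n : is_subgroup (level_constant n).
Proof.
  repeat split.
  - intros y z k _ _; rewrite !cocycle_one; reflexivity.
  - intros a b ha hb y z k hy hz; rewrite !cocycle_mul, (hb y z k hy hz); f_equal.
    apply (ha _ _ (gmul H b k)); apply (coding_act _ _ _ _ _ _ hP); assumption.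
  - intros a ha y z k hy hz; rewrite !cocycle_inv; f_equal.
    apply (ha _ _ (gmul H (ginv H a) k)); apply (coding_act _ _ _ _ _ _ hP); assumption.
Qed.

Hypothesis hcompact : Defs.compact opX.
Hypothesis hlocal : forall y h, exists g V, clopen opY V /\ V y /\
  forall z, V z -> psi' (actY h z) = actX g (psi' z).

(** Compactness is applied on [X], to preimages under [psi] of cells on which [c h] is constant. The
    deepest level in a finite subcover works. *)
Lemma level_constant_exists h : exists n, level_constant n h.
Proof.
  (* [good n U] says that [c h] is constant on every level-[n] cell meeting [psi(U)]. It persists
     when [n] grows, so a maximum over the subcover can be taken. *)
  set (good := fun n (U : X -> Prop) => forall x z k, U x ->
    P n k (psi x) -> P n k (psi z) -> c h (psi x) = c h (psi z)).
  destruct (hcompact (fun U => opX U /\ exists n, good n U)) as (l & hl & hcover).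
  - intros U [hU _]; exact hU.
  - intros x; destruct (hlocal (psi x) h) as (g & V & [hV _] & hVx & hg).
    (* The level [n] is taken so deep that the whole cell of [psi x] lies in [V], where [c h] is the
       constant [g]. *)
    destruct (proj1 (cc_open hP V) hV _ hVx) as [n hn].
    exists (fun z => exists k, P n k (psi x) /\ P n k (psi z)).
    split; [split |].
    + apply (cpsi _ (coding_cell_open _ _ _ _ _ _ hP n (psi x))).
    + exists n; intros w z k (k' & hx & hw) hkw hkz.
      assert (hz : P n k' (psi z)).
      { exact (coding_cell_trans _ _ _ _ _ _ hP n k k' _ _ hkw hkz hw). }
      rewrite (cocycle_unique h (psi w) g), (cocycle_unique h (psi z) g);
        [reflexivity | |]; apply hg; eapply hn; eauto.
    + destruct (cc_total hP n (psi x)) as [k hk]; exists k; split; exact hk.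
  - assert (hmax : exists n, forall U, In U l -> good n U).
    { clear hcover; induction l as [| U l IH].
      - exists 0; intros U [].
      - destruct IH as [n hn]; [intros V hV; apply hl; right; exact hV |].
        destruct (hl U (or_introl eq_refl)) as [_ [m hm]].
        exists (Nat.max n m); intros V hV x z k hx hkx hkz; destruct hV as [<- | hV].
        + apply (hm x z k hx); apply (coding_antitone _ _ _ _ _ _ hP m (Nat.max n m));
            auto; lia.
        + apply (hn V hV x z k hx); apply (coding_antitone _ _ _ _ _ _ hP n (Nat.max n m));
            auto; lia. }
    destruct hmax as [n hn]; exists n; intros y z k hy hz.
    destruct (hcover (psi' y)) as (U & hU & hUy).
    pose proof (hn U hU (psi' y) (psi' z) k hUy) as e; rewrite !psipsi' in e; auto.
Qed.

Lemma level_constant_uniform :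
  finitely_generated H -> exists n, forall h, level_constant n h.
Proof.
  intros [S hS].
  assert (hmax : exists n, forall s, In s S -> level_constant n s).
  { clear hS; induction S as [| s S IH].
    - exists 0; intros s [].
    - destruct IH as [n hn], (level_constant_exists s) as [m hm].
      exists (Nat.max n m); intros t [<- | ht].
      + apply (level_constant_mono m); [lia | exact hm].
      + apply (level_constant_mono n); [lia | auto]. }
  destruct hmax as [n hn]; exists n; intros h.
  exact (hS h _ (level_constant_subgroup n) hn).
Qed.

End Coded.

(** * Transporting the coding *)

Section Transport.
Variables (Hs : nat -> H -> Prop) (P : nat -> H -> Y -> Prop).
Hypothesis hP : coset_coding Hs opY actY P.
Hypothesis hconst : forall h, level_constant P 0 h.
Variable y0 : Y.
Hypothesis hy0 : forall n, P n (gone H) y0.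

(** The image of [H_n] under [theta h = c h y0]. Only on the right factor in [H_0] is [theta] shown
    multiplicative, so the subgroup property needs an argument. *)
Definition transport_seq (n : nat) (g : G) : Prop := exists h, Hs n h /\ c h y0 = g.

Definition transport_coding (n : nat) (g : G) (x : X) : Prop :=
  exists h, P n h (psi x) /\ c h y0 = g.

(** The point [g psi'(y0)] is carried by [psi] into the [H]-orbit of [y0], say to [h y0]; this [h]
    works. *)
Lemma cocycle_base_surj g : exists h, c h y0 = g.
Proof.
  destruct (horbit g (psi' y0)) as [h hh]; exists h; apply cocycle_unique.
  rewrite psipsi' in hh; rewrite <- hh; apply psi'psi.
Qed.

Lemma cocycle_base h n y : P n (gone H) y -> c h y = c h y0.
Proof.
  intros hy; apply (hconst h y y0 (gone H)); [| apply hy0].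
  apply (coding_antitone _ _ _ _ _ _ hP 0 n); [lia | exact hy].
Qed.

Lemma base_orbit_coding n a b : P n a (actY b y0) <-> Hs n (gmul H (ginv H a) b).
Proof.
  rewrite (cc_act hP), (cc_coset hP n _ _ (hy0 n)), ginv_1, gmul_1l.
  assert (hsub : is_subgroup (Hs n)) by apply (cc_seq hP).
  split; apply coset_sym; exact hsub.
Qed.

(** Translation by [h] in [Y] becomes translation by [theta h] in [X] on the base cell (the cell of
    the trivial coset), because [c h] has the constant value [theta h] there. *)
Lemma coding_pullback n h x :
  P n h (psi x) <-> P n (gone H) (psi (actX (ginv G (c h y0)) x)).
Proof.
  assert (hinv : forall v, P n h v <-> P n (gone H) (actY (ginv H h) v)).
  { intros v; rewrite (cc_act hP); gnorm; reflexivity. }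
  split.
  - intros hx; apply hinv in hx; set (v := actY (ginv H h) (psi x)) in *.
    (* As [v] lies in the base cell, [x = psi' (h v) = theta(h) psi'(v)]. *)
    replace (actX (ginv G (c h y0)) x) with (psi' v); [rewrite psipsi'; exact hx |].
    rewrite <- (psi'psi x), <- (act_KV H Y opY actY hYact h (psi x)); fold v.
    rewrite hc, (cocycle_base h n v hx), (act_VK G X opX actX hXact); reflexivity.
  - intros hw; set (w := actX (ginv G (c h y0)) x) in *.
    apply hinv; replace (psi x) with (actY h (psi w)).
    + rewrite (act_VK H Y opY actY hYact); exact hw.
    + rewrite <- (psipsi' (actY h (psi w))), hc, psi'psi, (cocycle_base h n _ hw).
      unfold w; rewrite (act_KV G X opX actX hXact); reflexivity.
Qed.

Lemma transport_codingE n h x : transport_coding n (c h y0) x <-> P n h (psi x).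
Proof.
  split.
  - intros (k & hk & e); apply cocycle_inj in e; subst k; exact hk.
  - intros hk; exists h; split; [exact hk | reflexivity].
Qed.

(** This describes the cell of [g] as the [g]-translate of the base cell, which makes equivariance
    under [G] immediate. *)
Lemma transport_coding_base n g x :
  transport_coding n g x <-> P n (gone H) (psi (actX (ginv G g) x)).
Proof.
  destruct (cocycle_base_surj g) as [h <-].
  rewrite transport_codingE; apply coding_pullback.
Qed.

(** The key identity. It is read off from the point [b y0]: being in the cell of [a] means, after
    pulling back, that [theta(a)^-1 theta(b)] keeps [psi'(y0)] in the base cell. *)
Lemma transport_coset n a b :
  transport_seq n (gmul G (ginv G (c a y0)) (c b y0)) <-> Hs n (gmul H (ginv H a) b).
Proof.
  rewrite <- base_orbit_coding.
  replace (actY b y0) with (psi (actX (c b y0) (psi' y0)))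
    by (rewrite <- hc; apply psipsi').
  rewrite coding_pullback, <- (proj1 (proj2 hXact)).
  (* Writing the quotient as [theta(k)] turns both sides into [k] belonging to [H_n]. *)
  destruct (cocycle_base_surj (gmul G (ginv G (c a y0)) (c b y0))) as [k <-].
  rewrite <- hc, psipsi', base_orbit_coding, ginv_1, gmul_1l.
  split.
  - intros (k' & hk & e); apply cocycle_inj in e; subst k'; exact hk.
  - intros hk; exists k; split; [exact hk | reflexivity].
Qed.

Lemma transport_subgroup n : is_subgroup (transport_seq n).
Proof.
  assert (hsub : is_subgroup (Hs n)) by apply (cc_seq hP).
  assert (hone : transport_seq n (gone G)).
  { exists (gone H); split; [apply hsub | apply cocycle_one]. }
  assert (hinv : forall a, transport_seq n a -> transport_seq n (ginv G a)).
  { intros a; destruct (cocycle_base_surj a) as [h <-]; intros (k & hk & e).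
    apply cocycle_inj in e; subst k.
    rewrite <- (gmul_1r G (ginv G _)), <- (cocycle_one y0), transport_coset, gmul_1r.
    apply hsub, hk. }
  repeat split; [exact hone | | exact hinv].
  (* The product [a b] is viewed as [theta(h)^-1 theta(k)] with [theta(h) = a^-1], the form that
     [transport_coset] handles. *)
  intros a b ha hb; apply hinv in ha.
  destruct ha as (h & hh & ea), hb as (k & hk & <-).
  rewrite <- (ginv_V G a), <- ea; apply transport_coset.
  apply hsub; [apply hsub |]; assumption.
Qed.

Lemma transport_index n k : has_index (Hs n) k -> has_index (transport_seq n) k.
Proof.
  intros (reps & hlen & hdist & hall).
  exists (map (fun h => c h y0) reps); split; [rewrite length_map; exact hlen |]; split.
  (* The default value of [nth] must be [theta(1)] for [map_nth] to apply, so [gone G] is rewritten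
     first. *)
  - intros i j hi hj hij; rewrite <- (cocycle_one y0).
    rewrite !(map_nth (fun h => c h y0)), transport_coset; auto.
  - intros g; destruct (cocycle_base_surj g) as [h <-], (hall h) as (r & hr & hrh).
    exists (c r y0); split; [apply (in_map (fun h => c h y0)), hr |].
    apply transport_coset, hrh.
Qed.

(** The bijection [theta] and [transport_coset] pull most fields back to [Y]; equivariance instead
    comes from [transport_coding_base]. *)
Lemma transport_coset_coding : coset_coding transport_seq opX actX transport_coding.
Proof.
  split.
  - split.
    + intros n; split; [apply transport_subgroup |].
      destruct (proj1 (cc_seq hP) n) as [_ [k hk]]; exists k; apply transport_index, hk.
    + intros n g (h & hh & e); exists h; split; [apply (cc_seq hP), hh | exact e].
  - intros n g x hg g'.
    destruct (cocycle_base_surj g) as [h <-], (cocycle_base_surj g') as [h' <-].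
    rewrite transport_codingE in *; rewrite transport_coset.
    apply (cc_coset hP), hg.
  - intros n x; destruct (cc_total hP n (psi x)) as [h hh].
    exists (c h y0), h; split; [exact hh | reflexivity].
  - intros n g x (h & hh & e); exists h; split; [apply (cc_dec hP), hh | exact e].
  - intros n g k x; rewrite !transport_coding_base, <- (proj1 (proj2 hXact)); gnorm.
    reflexivity.
  - intros U; rewrite (homeomorphism_open opX opY psi psi' U psi'psi cpsi cpsi').
    rewrite (cc_open hP); split.
    + intros hU x hx; destruct (hU (psi x)) as [n hn].
      { rewrite psi'psi; exact hx. }
      exists n; intros g z hgx hgz; destruct (cocycle_base_surj g) as [h <-].
      rewrite transport_codingE in hgx, hgz.
      rewrite <- (psi'psi z); exact (hn h _ hgx hgz).
    + intros hU y hy; destruct (hU _ hy) as [n hn]; exists n; intros h z hhy hhz.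
      apply (hn (c h y0)); apply transport_codingE; rewrite psipsi'; assumption.
  - intros a ha; destruct (choose _ (fun n => cocycle_base_surj (a n))) as [b hb].
    destruct (cc_complete hP b) as [y hy].
    { intros n; apply transport_coset; rewrite !hb; apply ha. }
    exists (psi' y); intros n; rewrite <- hb, transport_codingE, psipsi'; apply hy.
  - intros x z h; rewrite <- (psi'psi x), <- (psi'psi z); f_equal.
    apply (cc_sep hP); intros n; destruct (h n) as (g & hx & hz).
    destruct (cocycle_base_surj g) as [k <-]; exists k.
    rewrite transport_codingE in hx, hz; auto.
Qed.

(** For [b] in [H_0] the point [b y0] stays in the level-0 cell of [y0], so [c a] takes the same
    value at both points. *)
Lemma transport_morphism a b :
  Hs 0 b -> c (gmul H a b) y0 = gmul G (c a y0) (c b y0).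
Proof.
  intros hb; rewrite cocycle_mul; f_equal; apply (cocycle_base a 0).
  apply base_orbit_coding; rewrite ginv_1, gmul_1l; exact hb.
Qed.

End Transport.
End OrbitEquivalence.

Theorem theorem3p3 (G H : Group) (X Y : Type)
  (opX : (X -> Prop) -> Prop) (actX : G -> X -> X)
  (opY : (Y -> Prop) -> Prop) (actY : H -> Y -> Y)
  (hGc : countable_group G)
  (hHfg : finitely_generated H) (hHrf : residually_finite H)
  (hYtop : is_topology opY) (hYact : continuous_action opY actY)
  (hYodo : is_odometer opY actY) (hYfree : free_action actY)
  (hX : cantor_space opX) (hXact : continuous_action opX actX)
  (hXfree : free_action actX)
  (hcoe : continuously_orbit_equivalent opX actX opY actY) :
  (exists Gs : nat -> G -> Prop, determines Gs opX actX /\ odo_free Gs) /\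
  structurally_conjugate opX actX opY actY /\
  (exists (K : G -> Prop) (L : H -> Prop) (theta : H -> G) (k : nat),
     is_subgroup K /\ is_subgroup L /\ has_index K k /\ has_index L k /\
     (forall a b, L a -> L b -> theta (gmul H a b) = gmul G (theta a) (theta b)) /\
     (forall a b, L a -> L b -> theta a = theta b -> a = b) /\
     (forall g, K g <-> exists h, L h /\ theta h = g)).
Proof.
  destruct hcoe as (psi & psi' & psi'psi & psipsi' & cpsi & cpsi' & horb & _ & hlocal).
  assert (horbit : forall g x, exists h, psi (actX g x) = actY h (psi x)).
  { intros g x; apply horb; exists g; reflexivity. }
  (* One choice over pairs yields the cocycle; local constancy is recovered later from [hlocal] by
     uniqueness. *)
  destruct (choose (fun (p : H * Y) g => psi' (actY (fst p) (snd p)) = actX g (psi' (snd p))))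
    as [c0 hc0].
  { intros [h y]; destruct (hlocal y h) as (g & V & _ & hy & hV); exists g; apply hV, hy. }
  set (c := fun h y => c0 (h, y)).
  assert (hc : forall h y, psi' (actY h y) = actX (c h y) (psi' y)).
  { intros h y; apply (hc0 (h, y)). }
  destruct hYodo as [Hs0 hHs0].
  destruct (determines_coset_coding hHs0) as [P0 hP0].
  assert (hcompact : Defs.compact opX) by apply hX.
  destruct (level_constant_uniform G H X Y opX actX opY actY hXact hXfree hYact
    psi psi' psipsi' cpsi c hc Hs0 P0 hP0 hcompact hlocal hHfg) as [N hN].
  (* After the shift every [c h] is constant on level-0 cells, so [H_0] is the original [H_N]. *)
  pose proof (coding_shift _ _ _ _ _ _ hP0 N) as hP.
  set (Hs := fun n => Hs0 (N + n)) in hP; set (P := fun n => P0 (N + n)) in hP.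
  assert (hconst : forall h, level_constant G H Y c P 0 h).
  { intros h; unfold level_constant, P; rewrite Nat.add_0_r; exact (hN h). }
  (* The constant sequence of identities is compatible; completeness supplies the point coding the
     trivial cosets. *)
  destruct (cc_complete hP (fun _ => gone H)) as [y0 hy0].
  { intros n; apply coset_refl, (cc_seq hP). }
  set (theta := fun h => c h y0).
  set (Gs := transport_seq G H Y c Hs y0).
  assert (hcode : coset_coding Gs opX actX (transport_coding G H X Y psi c P y0)).
  { exact (transport_coset_coding G H X Y opX actX opY actY hXact hXfree hYact hYfree
      psi psi' psi'psi psipsi' cpsi cpsi' horbit c hc Hs P hP hconst y0 hy0). }
  pose proof (coset_coding_determines hcode) as hdetX.
  pose proof (coset_coding_determines hP) as hdetY.
  assert (hmul : forall a b, Hs 0 a -> Hs 0 b ->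
    theta (gmul H a b) = gmul G (theta a) (theta b)).
  { intros a b _ hb.
    exact (transport_morphism G H X Y opX actX opY actY hXact hXfree hYact
      psi' c hc Hs P hP hconst y0 hy0 a b hb). }
  assert (hinj : forall a b, Hs 0 a -> Hs 0 b -> theta a = theta b -> a = b).
  { intros a b _ _.
    exact (cocycle_inj G H X Y actX opY actY hYact hYfree psi psi' psipsi' c hc a b y0). }
  assert (himg : forall n g, Gs n g <-> exists h, Hs n h /\ theta h = g).
  { intros n g; reflexivity. }
  destruct (proj1 (cc_seq hP) 0) as [hL [k hk]].
  assert (hk' : has_index (Gs 0) k).
  { exact (transport_index G H X Y opX actX opY actY hXact hXfree hYact hYfree
      psi psi' psi'psi psipsi' horbit c hc Hs P hP hconst y0 hy0 0 k hk). }
  split; [| split].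
  - exists Gs; split; [exact hdetX | exact (determines_free hdetX hXfree)].
  - exists Gs, Hs, theta; do 5 (split; [assumption |]).
    exists k; split; assumption.
  - exists (Gs 0), (Hs 0), theta, k.
    split; [apply (cc_seq hcode) |].
    repeat (split; [assumption |]); intros g; apply himg.
Qed.
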